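(* Let $n\ge 1$. We have $$|s^{-1}(\mathrm{Av}_n(132,231,321))|=|s^{-1}(\mathrm{Av}_n(132,312,321))|=\binom{2n-2}{n-1}.$$ For every integer $m\ge 0$, the number of elements of $s^{-1}(\mathrm{Av}_n(132,231,321))$ with exactly $m$ descents and the number of elements of $s^{-1}(\mathrm{Av}_n(132,312,321))$ with exactly $m$ descents are both equal to $$\binom{n-1}{m}^2.$$ For every integer $m\ge 0$, the number of elements of $s^{-1}(\mathrm{Av}_n(132,231,321))$ with exactly $m$ peaks and the number of elements of $s^{-1}(\mathrm{Av}_n(132,312,321))$ with exactly $m$ peaks are both equal to $$2^{n-2m-1}\binom{n-1}{2m}\binom{2m}{m}.$$
   Context: $S_n$ is the set of permutations of $\{1,\ldots,n\}$, written as words. The stack-sorting map $s$ is defined recursively on words of distinct positive integers: $s$ sends the empty word to itself, and if $\pi=LNR$ where $N$ is the largest entry of $\pi$, then $s(\pi)=s(L)s(R)N$. Thus $s$ maps $S_n$ to $S_n$, and $s^{-1}(A)=\{\sigma\in S_n: s(\sigma)\in A\}$ for $A\subseteq S_n$. $\mathrm{Av}_n(\tau^{(1)},\ldots,\tau^{(r)})$ is the set of permutations in $S_n$ avoiding (in the classical sense) all the patterns $\tau^{(1)},\ldots,\tau^{(r)}$. A descent of $\pi\in S_n$ is an index $i\in\{1,\ldots,n-1\}$ with $\pi_i>\pi_{i+1}$; a peak is an index $i\in\{2,\ldots,n-1\}$ with $\pi_{i-1}<\pi_i>\pi_{i+1}$. Binomial coefficients $\binom ab$ are $0$ unless $0\le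 b\le a$. *)

(* Defs.v *)
From mathcomp Require Import all_boot.
From mathcomp Require Import finmap.

Set Implicit Arguments.
Unset Strict Implicit.
Unset Printing Implicit Defensive.

Local Open Scope fset_scope.

Definition word := seq nat.

Definition Sn (n : nat) : {fset word} := [fset w in permutations (iota 1 n)].

Lemma mem_Sn (n : nat) (w : word) : (w \in Sn n) = perm_eq w (iota 1 n).
Proof. by rewrite inE /= mem_permutations. Qed.

Definition maxword (w : word) : nat := \max_(x <- w) x.

(* The first argument is fuel; [size w] is enough, see [stack_sortE]. *)
Fixpoint stack_sort_rec (k : nat) (w : word) : word :=
  if k isn't k'.+1 then [::] else
  if w is [::] then [::] else
  let N := maxword w in
  stack_sort_rec k' (take (index N w) w) ++
  stack_sort_rec k' (drop (index N w).+1 w) ++ [:: N].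

Definition stack_sort (w : word) : word := stack_sort_rec (size w) w.

Definition stack_sort_preim (n : nat) (A : {fset word}) : {fset word} :=
  [fset w in Sn n | stack_sort w \in A].

Definition order_isomorphic (u v : word) : bool :=
  (size u == size v) &&
  [forall i : 'I_(size u), forall j : 'I_(size u),
     (nth 0 u i < nth 0 u j) == (nth 0 v i < nth 0 v j)].

Definition contains (w t : word) : bool :=
  [exists m : (size w).-tuple bool, order_isomorphic (mask m w) t].

Definition avoids (w t : word) : bool := ~~ contains w t.

Definition Av (n : nat) (ts : seq word) : {fset word} :=
  [fset w in Sn n | all (avoids w) ts].

(* Letters are numbered from 1. *)
Definition letter (w : word) (i : nat) : nat := nth 0 w i.-1.

Definition descents (w : word) : seq nat :=
  [seq i <- index_iota 1 (size w) | letter w i > letter w i.+1].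

Definition peaks (w : word) : seq nat :=
  [seq i <- index_iota 2 (size w) |
     (letter w i.-1 < letter w i) && (letter w i > letter w i.+1)].

Definition with_descents (A : {fset word}) (m : nat) : {fset word} :=
  [fset w in A | size (descents w) == m].

Definition with_peaks (A : {fset word}) (m : nat) : {fset word} :=
  [fset w in A | size (peaks w) == m].

Lemma containsP (w t : word) :
  reflect (exists2 u, subseq u w & order_isomorphic u t) (contains w t).
Proof.
apply: (iffP existsP) => [[m ut]|[u /subseqP[m sz_m ->] ut]].
  by exists (mask m w); rewrite ?mask_subseq.
by move/eqP in sz_m; exists (Tuple sz_m).
Qed.

Lemma maxword_cat (L R : word) (N : nat) :
  all (ltn^~ N) L -> all (ltn^~ N) R -> maxword (L ++ N :: R) = N.
Proof.
move=> /allP hL /allP hR; rewrite /maxword big_cat big_cons /=.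
have hb s : (forall x, x \in s -> x < N) -> \max_(x <- s) x <= N.
  by move=> h; apply/bigmax_leqP_seq => x /h/ltnW.
by rewrite (maxn_idPl (hb R hR)) (maxn_idPr (hb L hL)).
Qed.

Lemma maxword_in (x : nat) (w : word) : maxword (x :: w) \in x :: w.
Proof.
elim: w x => [|y w IH] x; first by rewrite /maxword big_seq1 mem_head.
rewrite /maxword big_cons -/(maxword _) inE.
by case: leqP => _; rewrite ?eqxx // IH orbT.
Qed.

Lemma stack_sort_fuel (k l : nat) (w : word) :
  size w <= k -> size w <= l -> stack_sort_rec k w = stack_sort_rec l w.
Proof.
elim: k l w => [|k IH] [|l] [|x w] //= sk sl.
have := maxword_in x w; move: (maxword _) => N Nw.
have si : index N (x :: w) <= size w by rewrite -ltnS -index_mem in Nw *.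
have st : size (take (index N (x :: w)) (x :: w)) <= size w.
  by rewrite size_take_min (leq_trans (geq_minl _ _)).
have sd : size (drop (index N (x :: w)) w) <= size w.
  by rewrite size_drop leq_subr.
by congr (_ ++ (_ ++ _)); apply: IH; apply: leq_trans; eassumption.
Qed.

Lemma stack_sort_nil : stack_sort [::] = [::].
Proof. by []. Qed.

Lemma stack_sortE (L R : word) (N : nat) :
  all (ltn^~ N) L -> all (ltn^~ N) R ->
  stack_sort (L ++ N :: R) = stack_sort L ++ stack_sort R ++ [:: N].
Proof.
move=> hL hR; rewrite {1}/stack_sort size_cat /= addnS /=.
case E: (L ++ N :: R) => [|x w]; first by case: L E {hL}.
rewrite -E maxword_cat //.
have NL : N \notin L by apply/negP => /(allP hL) /=; rewrite ltnn.
rewrite index_cat (negPf NL) /= eqxx addn0 take_size_cat //.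
rewrite -(cat_rcons N L R) drop_size_cat ?size_rcons //.
by congr (_ ++ (_ ++ _)); apply: stack_sort_fuel; rewrite ?leq_addl ?leq_addr.
Qed.

Lemma perm_stack_sort (w : word) : perm_eq (stack_sort w) w.
Proof.
suff: forall k v, size v <= k -> perm_eq (stack_sort_rec k v) v by exact.
elim=> [|k IH] [|x v] //= sk; move: v sk => {}w sk.
have := maxword_in x w; move: (maxword _) => N Nw.
have si : index N (x :: w) <= size w by rewrite -ltnS -index_mem in Nw *.
have st : size (take (index N (x :: w)) (x :: w)) <= k.
  by rewrite size_take_min (leq_trans (geq_minl _ _)) // (leq_trans si).
have sd : size (drop (index N (x :: w)) w) <= k.
  by rewrite size_drop (leq_trans (leq_subr _ _)).
rewrite -[X in perm_eq _ X](cat_take_drop (index N (x :: w))).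
have -> : drop (index N (x :: w)) (x :: w) = N :: drop (index N (x :: w)) w.
  by rewrite (drop_nth 0) ?index_mem // nth_index.
apply: perm_cat; first exact: IH.
by rewrite cats1 perm_rcons perm_cons; apply: IH.
Qed.

Lemma stack_sort_Sn (n : nat) (w : word) : w \in Sn n -> stack_sort w \in Sn n.
Proof. by rewrite !mem_Sn; apply: perm_trans; apply: perm_stack_sort. Qed.

(* Main.v *)
(* A permutation is the in-order reading of a decreasing binary tree, whose
   postorder reading is its image by the stack-sorting map; descents are the
   nodes with a right child and peaks the nodes with two children.  The two
   classes of avoiders are { k 1 ... k-1 k+1 ... n } and
   { 2 ... k 1 k+1 ... n }.

   Label the nodes of a tree in postorder by 2 ... k 1 k+1 ... n: the labelling
   is decreasing exactly when the k-th node is a leaf.  So the preimages of the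
   second class are the trees with a marked leaf.  For the first class the
   label k of the first leaf must be smaller than that of its parent, and
   exchanging two subtrees turns such pairs (tree, k) into trees with a marked
   leaf, without changing the numbers of nodes of each kind.

   A tree with a marked leaf is a path of left and right turns with a subtree
   hanging at each turn.  Reading these subtrees in preorder, each node being
   written as the pair of bits (has a left child, has a right child), and
   exchanging 00 and 11 in the codes of the right turns, gives each word in
   {00, 01, 10, 11}^(n-1) with as many 00 as 11 exactly once (first passage
   decomposition).  Such words are pairs of (n-1)-bit words subject to one
   equation, and are counted by products of binomial coefficients. *)
From HB Require Import structures.
Require Import Defs.
From mathcomp Require Import all_boot.
From mathcomp Require Import finmap zify ring.

Set Implicit Arguments.
Unset Strict Implicit.
Unset Printing Implicit Defensive.

(** * Binary trees, contexts and their codes *)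

Inductive tree := Empty | Node of tree & tree.

Definition nonempty (t : tree) : bool := if t is Node _ _ then true else false.

Definition leaf : tree := Node Empty Empty.

Fixpoint nodes (t : tree) : nat :=
  if t is Node l r then (nodes l + nodes r).+1 else 0.

Lemma nodes_gt0 t : (0 < nodes t) = nonempty t.
Proof. by case: t. Qed.

Lemma nodes0 t : nodes t = 0 -> t = Empty.
Proof. by case: t. Qed.

Notation code := (seq (bool * bool)).

Fixpoint tree_code (t : tree) : code :=
  if t is Node l r
  then (nonempty l, nonempty r) :: tree_code l ++ tree_code r else [::].

Definition nleaf (c : code) : nat := count_mem (false, false) c.
Definition nfork (c : code) : nat := count_mem (true, true) c.
Definition nright (c : code) : nat := count snd c.

Lemma nleaf_cat c d : nleaf (c ++ d) = nleaf c + nleaf d.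
Proof. exact: count_cat. Qed.
Lemma nfork_cat c d : nfork (c ++ d) = nfork c + nfork d.
Proof. exact: count_cat. Qed.
Lemma nright_cat c d : nright (c ++ d) = nright c + nright d.
Proof. exact: count_cat. Qed.
Definition count_catE := (nleaf_cat, nfork_cat, nright_cat).

Lemma size_tree_code t : size (tree_code t) = nodes t.
Proof. by elim: t => //= l IHl r IHr; rewrite size_cat IHl IHr. Qed.

(** A fork joins two subtrees with one surplus leaf each; a node with a single child keeps the
    surplus of that child. *)
Lemma tree_code_balance t :
  nleaf (tree_code t) = nfork (tree_code t) + nonempty t.
Proof.
elim: t => //= l IHl r IHr; rewrite /nleaf /nfork /= -/(nleaf _) -/(nfork _).
by rewrite !count_catE IHl IHr; case: (nonempty l); case: (nonempty r) => /=; lia.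
Qed.

(** Each letter announces which subtrees follow, so a code marks its own end. Emptiness has to be
    known beforehand, since [Empty] has the empty code. *)
Lemma tree_code_prefix t u c d : nonempty t = nonempty u ->
  tree_code t ++ c = tree_code u ++ d -> t = u /\ c = d.
Proof.
elim: t u c d => [|l IHl r IHr] [|l' r'] c d //= _ [el er].
by rewrite -!catA => /(IHl _ _ _ el)[-> /(IHr _ _ _ er)[-> ->]].
Qed.

Lemma tree_code_inj : injective tree_code.
Proof.
move=> t u e; have ne : nonempty t = nonempty u.
  by rewrite -!nodes_gt0 -!size_tree_code e.
by have [] := @tree_code_prefix t u [::] [::] ne; rewrite ?cats0.
Qed.

HB.instance Definition _ := Equality.copy tree (inj_type tree_code_inj).

(** First passage: the tree ends where the leaves first outnumber the forks. After a leading fork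
    the surplus of the rest is at least two; the first subtree uses one, and enough is left for the
    second. *)
Lemma tree_code_parse c :
  nfork c < nleaf c -> exists t d, nonempty t /\ c = tree_code t ++ d.
Proof.
have [n] := ubnP (size c); elim: n c => // n IH [|[[] []] c] //= le_n.
- move=> lt1; have {}lt1 : (nfork c).+1 < nleaf c := lt1.
  have [||l [d [ne_l def_c]]] := IH c; try lia.
  have := tree_code_balance l; rewrite ne_l addn1 => bal.
  have ltd : nfork d < nleaf d.
    by move: lt1; rewrite def_c !count_catE bal; lia.
  have [||r [e [ne_r def_d]]] := IH d; try lia.
    by move: le_n; rewrite def_c size_cat; lia.
  exists (Node l r), e; split=> //=.
  by rewrite ne_l ne_r def_c def_d catA.
- move=> lt1; have [||l [d [ne_l ->]]] := IH c; [lia | exact: lt1 |].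
  by exists (Node l Empty), d; rewrite /= ne_l cats0.
- move=> lt1; have [||r [d [ne_r ->]]] := IH c; [lia | exact: lt1 |].
  by exists (Node Empty r), d; rewrite /= ne_r.
- by exists leaf, c.
Qed.

(** A tree with a hole, given by the path from the root to the hole: each step tells whether it
    turns right ([true]) and which subtree hangs on the other side. *)
Definition context := seq (bool * tree).

Fixpoint csize (z : context) : nat :=
  if z is (_, s) :: z' then (nodes s + csize z').+1 else 0.

Fixpoint plug (x : tree) (z : context) : tree :=
  match z with
  | [::] => x
  | (false, s) :: z' => Node (plug x z') s
  | (true, s) :: z' => Node s (plug x z')
  end.

(** These are the nodes that postorder visits before the plugged tree; the path nodes come after
    it. *)
Fixpoint left_size (z : context) : nat :=
  if z is (b, s) :: z' then (if b then nodes s else 0) + left_size z' else 0.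

Lemma nodes_plug x z : nodes (plug x z) = nodes x + csize z.
Proof. by elim: z => [|[[] s] z IH] /=; rewrite ?addn0 ?IH //; lia. Qed.

Lemma nonempty_plug x z : nonempty x -> nonempty (plug x z).
Proof. by case: z => // -[[]]. Qed.

Lemma left_size_le z : left_size z <= csize z.
Proof. by elim: z => //= -[[] s] z IH /=; lia. Qed.

(** The size equation puts the roots of [x] and [y] at the same postorder position. Paths turning
    different ways at a node lead to disjoint ranges of positions; a path ending at a node leads to
    the last position of that subtree. *)
Lemma plug_inj x y z1 z2 : nonempty x -> nonempty y ->
  left_size z1 + nodes x = left_size z2 + nodes y ->
  plug x z1 = plug y z2 -> x = y /\ z1 = z2.
Proof.
move=> nx ny; move: (nx) (ny); rewrite -!nodes_gt0 => nx0 ny0.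
elim: z1 z2 => [|[b s] z1 IH] [|[c t] z2] //=.
- move=> e exy; have := congr1 nodes exy.
  by case: c e exy => /= e _; rewrite nodes_plug; have := left_size_le z2; lia.
- move=> e exy; have := congr1 nodes exy.
  by case: b e exy => /= e _; rewrite nodes_plug; have := left_size_le z1; lia.
have := left_size_le z1; have := left_size_le z2.
case: b c => [] [] /= l2 l1 e [e1 e2].
- by rewrite e1 in e *; have [|//|-> ->] := IH z2; first lia.
- have := congr1 nodes e1; have := congr1 nodes e2; rewrite !nodes_plug; lia.
- have := congr1 nodes e1; have := congr1 nodes e2; rewrite !nodes_plug; lia.
- by rewrite e2; have [|//|-> ->] := IH z2; first lia.
Qed.

(* [left_size z + nodes x - 1] is the postorder position of the root of [x]. *)
Lemma plug_surj t k : k < nodes t -> exists x z,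
  [/\ nonempty x, t = plug x z & k.+1 = left_size z + nodes x].
Proof.
elim: t k => //= l IHl r IHr k lt_k.
have [lt_l|le_l] := ltnP k (nodes l).
  have [x [z [nx -> ->]]] := IHl k lt_l.
  by exists x, ((false, r) :: z).
have [lt_r|le_r] := ltnP (k - nodes l) (nodes r).
  have [x [z [nx e1 e2]]] := IHr _ lt_r.
  by exists x, ((true, l) :: z); split=> //=; [rewrite e1 | lia].
by exists (Node l r), [::]; split=> //=; lia.
Qed.

(** * Codes of contexts and balanced words *)

Definition flip (a : bool * bool) : bool * bool := (~~ a.2, ~~ a.1).

Lemma flipK : involutive flip.
Proof. by case=> [[] []]. Qed.

(* Flipping the code of a right step makes the first letter of each nonlinear
   step tell its direction, at the cost of exchanging leaves and forks. *)
Definition step_code (p : bool * tree) : code :=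
  if p.2 isn't Node _ _ then [:: (~~ p.1, p.1)]
  else let c := (true, true) :: tree_code p.2 in
       if p.1 then map flip c else c.

Definition context_code (z : context) : code := flatten (map step_code z).

Definition balanced (c : code) : bool := nleaf c == nfork c.

Lemma nleaf_flip c : nleaf (map flip c) = nfork c.
Proof. by rewrite /nleaf count_map; apply: eq_count => -[[] []]. Qed.

Lemma nfork_flip c : nfork (map flip c) = nleaf c.
Proof. by rewrite /nfork count_map; apply: eq_count => -[[] []]. Qed.

(** [flip] fixes 01 and 10 and exchanges 00 with 11, so each leaf gains a right child and each fork
    loses one. On a balanced word [nright] is thus preserved. *)
Lemma nright_flip c : nright (map flip c) + nfork c = nright c + nleaf c.
Proof.
rewrite /nright /nfork /nleaf; elim: c => // a c; case: a => [[] []] /=;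
by move: (count snd _) (count snd c) (count_mem _ c) (count_mem _ c); lia.
Qed.

Lemma size_step_code p : size (step_code p) = (nodes p.2).+1.
Proof.
by case: p => [[] [|l r]] //=; rewrite ?size_map /= size_cat !size_tree_code.
Qed.

Lemma size_context_code z : size (context_code z) = csize z.
Proof.
by elim: z => // -[b s] z IH; rewrite /= size_cat size_step_code IH.
Qed.

(** The letter 11 in front of the code of a nonempty tree makes up for its surplus leaf. *)
Lemma step_code_bal p : nleaf (step_code p) = nfork (step_code p).
Proof.
have bal l r : nleaf ((true, true) :: tree_code (Node l r)) =
               nfork ((true, true) :: tree_code (Node l r)).
  have -> c : nleaf ((true, true) :: c) = nleaf c by [].
  have -> c : nfork ((true, true) :: c) = (nfork c).+1 by [].
  by rewrite tree_code_balance addn1.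
case: p => [[] [|l r]] //; rewrite /step_code ?nleaf_flip ?nfork_flip.
  exact/esym/bal.
exact: bal.
Qed.

Lemma context_code_balanced z : balanced (context_code z).
Proof.
rewrite /balanced; elim: z => // p z /eqP IH.
by rewrite /= !count_catE IH step_code_bal.
Qed.

Lemma context_code_cons b s z :
  context_code ((b, s) :: z) = step_code (b, s) ++ context_code z.
Proof. by []. Qed.

(** The first letter tells the kind of step: 10 and 01 for a left or right turn with nothing
    hanging, 11 and 00 for a left or right turn with a nonempty tree, whose code then marks its own
    end. *)
Lemma step_code_prefix p q c d :
  step_code p ++ c = step_code q ++ d -> p = q /\ c = d.
Proof.
case: p q => [b [|s1 s2]] [b' [|t1 t2]].
- by case: b b' => [] [] //= [->].
- by case: b b' => [] [].
- by case: b b' => [] [].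
have pre u v := @tree_code_prefix (Node s1 s2) (Node t1 t2) u v erefl.
rewrite /step_code /fst /snd; move: (Node s1 s2) (Node t1 t2) pre => s t pre.
case: b b' => [] [] //=; last by case=> /pre[-> ->].
case=> /(congr1 (map flip)); rewrite !map_cat !(mapK flipK) => /pre[->].
by move/(congr1 (map flip)); rewrite !(mapK flipK) => ->.
Qed.

Lemma context_code_inj : injective context_code.
Proof.
elim=> [|[b s] z IH] [|[c t] w] //; rewrite ?context_code_cons.
- by move/(congr1 size); rewrite size_cat size_step_code.
- by move/(congr1 size); rewrite size_cat size_step_code.
by move/step_code_prefix=> [-> /IH ->].
Qed.

(** The first letter gives the kind of step. After 11 the rest has one leaf more than forks, so a
    tree can be cut off; after 00 the same holds for the flipped rest. What remains is again
    balanced. *)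
Lemma context_code_surj c : balanced c -> exists z, context_code z = c.
Proof.
rewrite /balanced; have [n] := ubnP (size c).
elim: n c => // n IH [|[[] []] c] /= le_n bal; first by exists [::].
- have [|t [d [nt def_c]]] := @tree_code_parse c.
    by have: nleaf c == (nfork c).+1 := bal; lia.
  have := tree_code_balance t; rewrite nt addn1 => balt.
  have bald : nleaf d == nfork d.
    have: nleaf c == (nfork c).+1 := bal.
    by rewrite def_c !count_catE balt; lia.
  have [|z ez] := IH d _ bald.
    by move: le_n; rewrite def_c size_cat; lia.
  exists ((false, t) :: z); rewrite def_c -ez /context_code /=.
  by case: t nt {def_c balt}.
- have [|z <-] := IH c _ bal; first by lia.
  by exists ((false, Empty) :: z).
- have [|z <-] := IH c _ bal; first by lia.
  by exists ((true, Empty) :: z).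
- have [|t [d [nt def_c]]] := @tree_code_parse (map flip c).
    rewrite nleaf_flip nfork_flip.
    by have: (nleaf c).+1 == nfork c := bal; lia.
  have := tree_code_balance t; rewrite nt addn1 => balt.
  have {}def_c : c = map flip (tree_code t) ++ map flip d.
    by rewrite -map_cat -def_c (mapK flipK).
  have bald : nleaf (map flip d) == nfork (map flip d).
    have: (nleaf c).+1 == nfork c := bal.
    by rewrite def_c !count_catE !(nleaf_flip, nfork_flip) balt; lia.
  have [|z ez] := IH (map flip d) _ bald.
    by move: le_n; rewrite def_c size_cat !size_map; lia.
  exists ((true, t) :: z); rewrite def_c -ez /context_code /=.
  by case: t nt {def_c balt}.
Qed.

(* The nodes lying on the path of the context are counted here, with the
   children they have once a nonempty tree is plugged in. *)
Fixpoint path_code (z : context) : code :=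
  if z is (b, s) :: z' then
    (~~ b || nonempty s, b || nonempty s) :: tree_code s ++ path_code z'
  else [::].

(** The letters of the path nodes depend on [x] only through its being nonempty. The statistics
    count letters, so the code is needed only up to order. *)
Lemma perm_plug_code x z : nonempty x ->
  perm_eq (tree_code (plug x z)) (tree_code x ++ path_code z).
Proof.
move=> nx; elim: z => [|[b s] z IH] /=; first by rewrite cats0.
rewrite perm_sym perm_catC /= -catA.
case: b; rewrite /= nonempty_plug // ?orbT perm_cons.
  by rewrite perm_cat2l perm_catC perm_sym.
by rewrite perm_catC perm_cat2r perm_catC perm_sym.
Qed.

Lemma path_code_cons b s z : path_code ((b, s) :: z) =
  ((~~ b || nonempty s, b || nonempty s) :: tree_code s) ++ path_code z.
Proof. by []. Qed.

(** The two codes differ only at right turns with a nonempty hanging tree, where one block is the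
    flip of the other. Such a block is balanced, so exchanging leaves and forks does not change the
    count. *)
Lemma nfork_context z : nfork (context_code z) = nfork (path_code z).
Proof.
elim: z => // -[b s] z IH; rewrite context_code_cons.
rewrite nfork_cat IH path_code_cons nfork_cat; congr (_ + _).
case: s b => [|l r] [] //; rewrite /step_code orbT nfork_flip.
by have := tree_code_balance (Node l r); rewrite addn1.
Qed.

Lemma nright_context z : nright (context_code z) = nright (path_code z).
Proof.
elim: z => // -[b s] z IH; rewrite context_code_cons.
rewrite nright_cat IH path_code_cons nright_cat; congr (_ + _).
case: s b => [|l r] [] //; rewrite /step_code orbT.
have /eqP := nright_flip ((true, true) :: tree_code (Node l r)).
have -> c : nleaf ((true, true) :: c) = nleaf c by [].
have -> c : nfork ((true, true) :: c) = (nfork c).+1 by [].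
by rewrite tree_code_balance addn1 eqn_add2r => /eqP.
Qed.

(** * Labelled trees and stack sorting *)

Lemma descents_cons2 x y w :
  size (descents [:: x, y & w]) = (x > y) + size (descents (y :: w)).
Proof.
rewrite !size_filter /index_iota !subSS !subn0 /=.
rewrite (iotaDl 1 1) count_map; congr (_ + _); apply: eq_in_count => i.
by rewrite mem_iota; case: i.
Qed.

Lemma peaks_cons3 x y v w :
  size (peaks [:: x, y, v & w]) =
    ((x < y) && (y > v)) + size (peaks [:: y, v & w]).
Proof.
rewrite !size_filter /index_iota !subSS !subn0 /=.
rewrite (iotaDl 1 2) count_map; congr (_ + _); apply: eq_in_count => i.
by rewrite mem_iota; case: i => [|[]].
Qed.

Lemma descents_max (L R : word) N :
  all (ltn^~ N) L -> all (ltn^~ N) R -> size (descents (L ++ N :: R)) =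
    size (descents L) + (R != [::]) + size (descents R).
Proof.
elim: L => [|x [|y L] IH] hL hR.
- by case: R hR => //= y R /andP[yN _]; rewrite descents_cons2 yN.
- move: hL => /= /andP[xN _]; rewrite descents_cons2 ltnNge (ltnW xN) /=.
  exact: IH.
- move: hL => /= /andP[_ hL].
  by rewrite descents_cons2 (IH hL hR) descents_cons2 !addnA.
Qed.

(** The letters next to [N] are not peaks of the whole word, being smaller than [N], nor of [L] or
    [R], being at an end. *)
Lemma peaks_max (L R : word) N :
  all (ltn^~ N) L -> all (ltn^~ N) R -> size (peaks (L ++ N :: R)) =
    size (peaks L) + ((L != [::]) && (R != [::])) + size (peaks R).
Proof.
elim: L => [|x [|y L] IH] hL hR.
- case: R hR => [|y [|v R]] //= /andP[yN _].
  by rewrite peaks_cons3 ltnNge (ltnW yN).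
- have := IH isT hR; move: hL => /= /andP[xN _].
  case: R hR {IH} => //= y R /andP[yN _] IH.
  by rewrite peaks_cons3 xN yN IH.
- have {IH} := IH _ hR; move: hL => /= /andP[_ hL] /(_ hL).
  case: L hL => [|v L] hL /= IH.
    by move: hL => /andP[yN _]; rewrite peaks_cons3 (ltnNge N) (ltnW yN) andbF.
  by rewrite !peaks_cons3 IH !addnA.
Qed.

(** * Decreasing labelled trees, read in order and in postorder *)

Lemma map_iota_addS (f : nat -> nat) o m n : map f (iota o (m + n).+1) =
  map f (iota o m) ++ map f (iota (o + m) n) ++ [:: f (o + m + n)].
Proof. by rewrite -addn1 !iotaD !map_cat /= addnA -catA. Qed.

(* [f] labels the nodes in postorder, starting from the index [o]. *)
Fixpoint inorder (f : nat -> nat) (o : nat) (t : tree) : word :=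
  if t is Node l r then
    inorder f o l ++ f (o + nodes l + nodes r) :: inorder f (o + nodes l) r
  else [::].

(** Postorder gives the descendants of a node the block of indices just before its own, so the
    condition at a node is a comparison over an interval. *)
Fixpoint decreasing (f : nat -> nat) (o : nat) (t : tree) : bool :=
  if t is Node l r then
    [&& all (fun i => f i < f (o + nodes l + nodes r))
            (iota o (nodes l + nodes r)),
        decreasing f o l & decreasing f (o + nodes l) r]
  else true.

Lemma size_inorder f o t : size (inorder f o t) = nodes t.
Proof.
by elim: t o => //= l IHl r IHr o; rewrite size_cat /= IHl IHr addnS.
Qed.

Lemma perm_inorder f o t : perm_eq (inorder f o t) (map f (iota o (nodes t))).
Proof.
elim: t o => // l IHl r IHr o.
rewrite [nodes _]/= map_iota_addS /=.
by apply: perm_cat => //; rewrite cats1 perm_sym perm_rcons perm_sym perm_cons.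
Qed.

Lemma decreasing_max f o l r : decreasing f o (Node l r) ->
  all (ltn^~ (f (o + nodes l + nodes r))) (inorder f o l) /\
  all (ltn^~ (f (o + nodes l + nodes r))) (inorder f (o + nodes l) r).
Proof.
move=> /= /and3P[]; rewrite iotaD all_cat => /andP[hl hr] _ _.
by split; rewrite (perm_all _ (perm_inorder _ _ _)) all_map.
Qed.

(** The root carries the largest label, so [stack_sort] follows the same recursion as postorder. *)
Lemma stack_sort_inorder f o t : decreasing f o t ->
  stack_sort (inorder f o t) = map f (iota o (nodes t)).
Proof.
elim: t o => // l IHl r IHr o dt; have [hl hr] := decreasing_max dt.
move: dt => /= /and3P[_ dl dr].
by rewrite stack_sortE // IHl // IHr // -map_iota_addS.
Qed.

Lemma inorder_nil f o t : (inorder f o t != [::]) = nonempty t.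
Proof. by rewrite -size_eq0 size_inorder -lt0n nodes_gt0. Qed.

Lemma nright_node l r : nright (tree_code (Node l r)) =
  nright (tree_code l) + nonempty r + nright (tree_code r).
Proof.
have -> : nright (tree_code (Node l r)) =
          nonempty r + nright (tree_code l ++ tree_code r) by [].
by rewrite nright_cat; lia.
Qed.

Lemma nfork_node l r : nfork (tree_code (Node l r)) =
  nfork (tree_code l) + (nonempty l && nonempty r) + nfork (tree_code r).
Proof.
have -> : nfork (tree_code (Node l r)) =
          ((nonempty l, nonempty r) == (true, true)) +
          nfork (tree_code l ++ tree_code r) by [].
by rewrite xpair_eqE !eqb_id nfork_cat; lia.
Qed.

Lemma descents_inorder f o t : decreasing f o t ->
  size (descents (inorder f o t)) = nright (tree_code t).
Proof.
elim: t o => // l IHl r IHr o dt; have [hl hr] := decreasing_max dt.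
case/and3P: dt => _ dl dr.
by rewrite nright_node descents_max // IHl // IHr // inorder_nil.
Qed.

Lemma peaks_inorder f o t : decreasing f o t ->
  size (peaks (inorder f o t)) = nfork (tree_code t).
Proof.
elim: t o => // l IHl r IHr o dt; have [hl hr] := decreasing_max dt.
case/and3P: dt => _ dl dr.
by rewrite nfork_node peaks_max // IHl // IHr // !inorder_nil.
Qed.

Lemma max_split (s : word) : s != [::] -> uniq s -> exists L R N,
  [/\ s = L ++ N :: R, all (ltn^~ N) L & all (ltn^~ N) R].
Proof.
case: s => // x w _; have := maxword_in x w.
have : forall y, y \in x :: w -> y <= maxword (x :: w).
  by move=> y hy; rewrite /maxword (big_rem y) //= leq_maxl.
move: (maxword _) => N; move: (x :: w) => s le_N N_s.
case/splitPr: N_s le_N => L R le_N.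
rewrite cat_uniq /= negb_or => /and4P[_ /andP[NL _] NR _].
exists L, R, N; split=> //; apply/allP => y hy /=; rewrite ltn_neqAle le_N.
- by rewrite andbT; apply: contraNneq NL => <-.
- by rewrite mem_cat hy.
- by rewrite andbT; apply: contraNneq NR => <-.
- by rewrite mem_cat inE hy !orbT.
Qed.

(** Split [s] at its maximum. Stack sorting preserves sizes, so the sorted word splits into the
    postorder labels of the two subtrees and of the root. *)
Lemma inorder_surj f o s : uniq s ->
  stack_sort s = map f (iota o (size s)) ->
  exists2 t, decreasing f o t & s = inorder f o t.
Proof.
have [n] := ubnP (size s); elim: n s o => // n IH s o le_n us.
have [->|s0] := eqVneq s [::]; first by exists Empty.
have [L [R [N [def_s hL hR]]]] := max_split s0 us.
move: us le_n; rewrite {}def_s => {s s0}; rewrite size_cat /= addnS => us le_n.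
rewrite stack_sortE // map_iota_addS.
have sz v : size (stack_sort v) = size v.
  by rewrite (perm_size (perm_stack_sort _)).
move/eqP; rewrite eqseq_cat ?sz ?size_map ?size_iota //.
rewrite eqseq_cat ?sz ?size_map ?size_iota // => /and3P[/eqP eL /eqP eR].
rewrite eqseq_cons andbT => /eqP eN.
move: us; rewrite cat_uniq /= => /and4P[uL _ _ uR].
have [|l dl eql] := IH L o _ uL eL.
  exact: leq_ltn_trans (leq_addr _ _) le_n.
have [|r dr eqr] := IH R (o + size L) _ uR eR.
  exact: leq_ltn_trans (leq_addl _ _) le_n.
have sl : size L = nodes l by rewrite eql size_inorder.
have sr : size R = nodes r by rewrite eqr size_inorder.
rewrite sl sr in eN eqr dr.
exists (Node l r); last by rewrite /= -eN -eql -eqr.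
rewrite /= dl dr !andbT iotaD all_cat -eN.
rewrite -(all_map f (ltn^~ N)) -(all_map f (ltn^~ N)).
by rewrite -!(perm_all _ (perm_inorder _ _ _)) -eql -eqr hL hR.
Qed.

(** The root label exceeds every label of the left part, so its position in the word gives the size
    of the left subtree. *)
Lemma inorder_inj f o t u : decreasing f o t -> decreasing f o u ->
  inorder f o t = inorder f o u -> t = u.
Proof.
elim: t o u => [|l IHl r IHr] o [|l' r'] // dt du e.
- by have := congr1 size e; rewrite !size_inorder.
- by have := congr1 size e; rewrite !size_inorder.
have sz : nodes l + nodes r = nodes l' + nodes r'.
  by have := congr1 size e; rewrite !size_inorder /= => -[].
have [hl _] := decreasing_max dt; have [hl' _] := decreasing_max du.
move: dt du e => /= /and3P[_ dl dr] /and3P[_ dl' dr'].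
rewrite -!addnA -sz in hl' *; rewrite -addnA in hl.
move: (f _) hl hl' => N hl hl' e.
have out s : all (ltn^~ N) s -> N \in s = false.
  by move=> /allP h; apply/negP => /h /=; rewrite ltnn.
have eqsz : nodes l = nodes l'.
  have := congr1 (index N) e; rewrite !index_cat /= eqxx !out //.
  by rewrite !size_inorder !addn0.
move/eqP: e; rewrite eqseq_cat ?size_inorder // eqseq_cons eqxx /= -eqsz.
move=> /andP[/eqP el /eqP er].
by rewrite (IHl _ _ dl dl' el) (IHr _ _ dr _ er) // eqsz.
Qed.

Lemma increasing_decreasing f o t :
  (forall i j, o <= i -> i < j -> j < o + nodes t -> f i < f j) ->
  decreasing f o t.
Proof.
elim: t o => //= l IHl r IHr o inc; apply/and3P; split.
- by apply/allP => i; rewrite mem_iota => hi; apply: inc; lia.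
- by apply: IHl => i j *; apply: inc; lia.
- by apply: IHr => i j *; apply: inc; lia.
Qed.

(** * The two families of labellings *)

(* [2 ... k+1 1 k+2 ... n], read from index [0] *)
Definition dip_word (k i : nat) : nat :=
  if i < k then i.+2 else if i == k then 1 else i.+1.

(* [k+1 1 ... k k+2 ... n], read from index [0] *)
Definition lead_word (k i : nat) : nat :=
  if i == 0 then k.+1 else if i <= k then i else i.+1.

Lemma dip_word_mono k i j : i < j -> j != k -> dip_word k i < dip_word k j.
Proof.
by rewrite /dip_word; case: (ltngtP i k); case: (ltngtP j k) => //; lia.
Qed.

Lemma dip_word_gt0 k i : 0 < dip_word k i.
Proof. by rewrite /dip_word; case: ifP => //; case: ifP. Qed.

Lemma dip_word_eq k : dip_word k k = 1.
Proof. by rewrite /dip_word ltnn eqxx. Qed.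

(** [dip_word k] is smaller than an earlier value only at index [k], and here that index belongs to
    the plugged leaf, which has no descendants. *)
Lemma decreasing_dip_plug o z :
  decreasing (dip_word (o + left_size z)) o (plug leaf z).
Proof.
elim: z o => [|[b s] z IH] o //=; have zs := left_size_le z.
have np := nodes_plug leaf z; rewrite /= in np.
case: b; rewrite /= np; apply/and3P; split.
- by apply/allP => i; rewrite mem_iota => hi; apply: dip_word_mono; lia.
- by apply: increasing_decreasing => i j *; apply: dip_word_mono; lia.
- by rewrite addnA; apply: IH.
- by apply/allP => i; rewrite mem_iota => hi; apply: dip_word_mono; lia.
- by rewrite add0n; apply: IH.
- by apply: increasing_decreasing => i j *; apply: dip_word_mono; lia.
Qed.

(** The node of index [k] has label 1, the least one, so nothing can lie below it. *)
Lemma decreasing_dip_inv k o t :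
  decreasing (dip_word k) o t -> o <= k < o + nodes t ->
  exists2 z, t = plug leaf z & k = o + left_size z.
Proof.
elim: t o => [|l IHl r IHr] o /=; first by move=> _; lia.
case/and3P=> /allP hroot dl dr hk.
have [lt_l|le_l] := ltnP k (o + nodes l).
  have [|z -> ->] := IHl o dl; first by lia.
  by exists ((false, r) :: z); rewrite /= ?add0n.
have [lt_r|le_r] := ltnP k (o + nodes l + nodes r).
  have [|z -> ->] := IHr _ dr; first by lia.
  by exists ((true, l) :: z); rewrite /= ?addnA.
have ek : k = o + nodes l + nodes r by lia.
have /eqP : nodes l + nodes r = 0.
  apply/eqP; rewrite eqn0Ngt; apply/negP => lt0.
  have := hroot o; rewrite mem_iota -ek dip_word_eq.
  by have := dip_word_gt0 k o; lia.
rewrite addn_eq0 => /andP[/eqP/nodes0 el /eqP/nodes0 er].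
by exists [::]; rewrite ?ek el er /= ?addn0.
Qed.

Lemma lead_word_mono k i j : 0 < i -> i < j -> lead_word k i < lead_word k j.
Proof.
rewrite /lead_word; case: i j => [|i] [|j] //= _ ij.
by case: (leqP i.+1 k); case: (leqP j.+1 k); lia.
Qed.

Lemma lead_word_gt k j : k < j -> lead_word k 0 < lead_word k j.
Proof. by rewrite /lead_word; case: j => // j kj; rewrite (leqNgt j.+1) kj. Qed.

Lemma lead_word_le k j : 0 < j <= k -> lead_word k j <= lead_word k 0.
Proof. by rewrite /lead_word; case: j => // j /= jk; rewrite jk; lia. Qed.

(* A tree with a marked leaf is turned into a tree and a label for its first
   leaf.  Follow the path to the marked leaf as long as it goes to the first
   leaf.  If it first departs from the way to the first leaf by going right at
   a node with left subtree [s], swap [s] with the marked leaf. *)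
Fixpoint lead_tree (z : context) : tree * nat :=
  match z with
  | [::] => (leaf, 0)
  | (false, s) :: z' => (Node (lead_tree z').1 s, (lead_tree z').2)
  | (true, Empty) :: z' => (Node Empty (lead_tree z').1, (lead_tree z').2)
  | (true, s) :: z' => (Node leaf (plug s z'), left_size z' + nodes s)
  end.

(** In the new tree the leaf on the left has postorder index 0, so [left_size z + nodes s] is the
    index of the root of [s]. This number tells where [s] went and lets the swap be undone. *)
Lemma lead_tree_right s z : nonempty s ->
  lead_tree ((true, s) :: z) = (Node leaf (plug s z), left_size z + nodes s).
Proof. by case: s. Qed.

Lemma nodes_lead_tree z : nodes (lead_tree z).1 = (csize z).+1.
Proof.
elim: z => //= -[[] [|l r]] z IH; rewrite /= ?IH ?nodes_plug /=; lia.
Qed.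

Lemma lead_tree_lt z : (lead_tree z).2 < nodes (lead_tree z).1.
Proof.
elim: z => //= -[[] [|l r]] z IH; rewrite /= ?nodes_plug /=; try lia.
by have := left_size_le z; lia.
Qed.

(** The two subtrees exchanged are nonempty, so every node keeps its letter and only the order
    changes. *)
Lemma perm_lead_tree z :
  perm_eq (tree_code (lead_tree z).1) (tree_code (plug leaf z)).
Proof.
elim: z => // -[[] s] z IH; last first.
  rewrite /= -!nodes_gt0 nodes_lead_tree nodes_plug addn_gt0 /= perm_cons.
  by rewrite perm_cat2r.
case: s => [|l r]; rewrite [lead_tree _]/=.
  by rewrite /= -!nodes_gt0 nodes_lead_tree nodes_plug addn_gt0 /= perm_cons.
rewrite [plug leaf _]/=; move: (Node l r) (isT : nonempty (Node l r)) => s ns.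
rewrite [tree_code]lock /= -lock /= !nonempty_plug // ns perm_cons.
rewrite (perm_trans (y := tree_code leaf ++ tree_code s ++ path_code z)) //.
  by rewrite /= perm_cons perm_plug_code.
by rewrite perm_catCA perm_cat2l perm_sym perm_plug_code.
Qed.

(** [lead_word k] increases except that its value at 0 exceeds those at 1 to [k]. So only the
    ancestors of the first leaf matter, and their indices must be beyond [k]. *)
Lemma decreasing_lead_tree z :
  decreasing (lead_word (lead_tree z).2) 0 (lead_tree z).1.
Proof.
elim: z => [|[[] s] z IH] //.
  have [e|s0] := posnP (nodes s).
    rewrite (nodes0 e) /=; rewrite !add0n IH andbT.
    apply/allP => -[|i]; rewrite mem_iota => hi.
      exact: lead_word_gt (lead_tree_lt z).
    by apply: lead_word_mono; lia.
  rewrite lead_tree_right -?nodes_gt0 //.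
  rewrite [X in lead_word X]/= [X in decreasing _ _ X]/=.
  have lz := left_size_le z; have np := nodes_plug s z.
  have n1 : nodes leaf = 1 by [].
  apply/and3P; split=> //.
    apply/allP => -[|i]; rewrite mem_iota np n1 => hi.
      by apply: lead_word_gt; lia.
    by apply: lead_word_mono; lia.
  by apply: increasing_decreasing => i j *; apply: lead_word_mono; lia.
have lt_k := lead_tree_lt z; have nT := nodes_lead_tree z.
rewrite /= IH /= !add0n; apply/andP; split.
  apply/allP => -[|i]; rewrite mem_iota => hi.
    by apply: lead_word_gt; lia.
  by apply: lead_word_mono; lia.
by apply: increasing_decreasing => i j *; apply: lead_word_mono; lia.
Qed.

Lemma decreasing_lead_inv k t : decreasing (lead_word k) 0 t -> k < nodes t ->
  exists z, lead_tree z = (t, k).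
Proof.
elim: t => //= l IHl r IHr; rewrite !add0n => /and3P[/allP hroot dl dr] lt_k.
(* If the root has a child, node 0 lies below it, so the index of the root must exceed [k]. *)
have lt_root : 0 < nodes l + nodes r -> k < nodes l + nodes r.
  move=> lt0; rewrite ltnNge; apply/negP => le_k.
  have := hroot 0; rewrite mem_iota add0n lt0 => /(_ isT).
  by rewrite ltnNge lead_word_le // lt0.
case: l IHl dl dr hroot lt_k lt_root => [|l1 l2] IHl dl dr hroot lt_k lt_root.
  have [r0|] := posnP (nodes r).
    move: lt_k; rewrite (nodes0 r0) /= => lt_k; exists [::] => /=.
    by have -> : k = 0 by lia.
  by move=> /lt_root/(IHr dr)[z ez]; exists ((true, Empty) :: z); rewrite /= ez.
have {lt_root} lt_root := lt_root isT.
have [/(IHl dl)[z ez]|le_l] := ltnP k (nodes (Node l1 l2)).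
  by exists ((false, r) :: z); rewrite /= ez.
(* Otherwise the root of the left subtree would be an ancestor of node 0 with index at most [k]. *)
have ll : Node l1 l2 = leaf.
  apply/eqP; have [e|] := posnP (nodes l1 + nodes l2).
    move/eqP: e; rewrite addn_eq0 => /andP[/eqP/nodes0-> /eqP/nodes0->].
    exact: eqxx.
  move=> lt0; move: dl => /= /and3P[/allP /(_ 0)].
  rewrite mem_iota !add0n lt0 => /(_ isT).
  by rewrite ltnNge lead_word_le // lt0; move: le_l => /=; lia.
rewrite {}ll in le_l lt_root lt_k *.
(* The left leaf takes index 0, so index [k] of the whole tree is index [k.-1] of [r]. *)
have [|x [z [nx -> ek]]] := @plug_surj r k.-1.
  by move: le_l lt_root => /=; lia.
exists ((true, x) :: z); case: x nx ek => //= x1 x2 _ ek; congr (_, _).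
by move: le_l ek => /=; lia.
Qed.

Lemma lead_tree_other b s z : ~~ (b && nonempty s) ->
  lead_tree ((b, s) :: z) =
    (if b then Node Empty (lead_tree z).1 else Node (lead_tree z).1 s,
     (lead_tree z).2).
Proof. by case: b s => [] []. Qed.

(** A swap leaves a single leaf as left subtree and a positive index. Without a swap, that leaf
    would be [lead_tree w], whose index is less than its size 1. *)
Lemma lead_tree_right_other s z b u w : nonempty s -> ~~ (b && nonempty u) ->
  lead_tree ((true, s) :: z) <> lead_tree ((b, u) :: w).
Proof.
move=> ns nu; rewrite lead_tree_right // lead_tree_other //.
case: b nu => _ // [e _ ek]; have := lead_tree_lt w.
by rewrite -ek -e; move: ns; rewrite -nodes_gt0 /=; lia.
Qed.

Lemma lead_tree_inj : injective lead_tree.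
Proof.
elim=> [|[b s] z IH] [|[c u] w] // e.
- by have := congr1 (fun p => nodes p.1) e; rewrite !nodes_lead_tree.
- by have := congr1 (fun p => nodes p.1) e; rewrite !nodes_lead_tree.
have [/andP[eb ns]|ns] := boolP (b && nonempty s);
  have [/andP[ec nu]|nu] := boolP (c && nonempty u).
- move: e; rewrite eb ec !lead_tree_right // => -[e1 e2].
  by have [-> ->] := plug_inj ns nu e2 e1.
- by move: e; rewrite eb => /(lead_tree_right_other ns nu).
- by move: e; rewrite ec => /esym/(lead_tree_right_other nu ns).
have nT y : nodes (lead_tree y).1 <> 0 by rewrite nodes_lead_tree.
move: e; rewrite !lead_tree_other //.
case: b c ns nu => [] [] /=.
- case: s u => // -[] // _ _ [e1 e2]; rewrite (IH w) //.
  by rewrite [LHS]surjective_pairing e1 e2 -surjective_pairing.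
- by move=> _ _ [e]; have := nT w; rewrite -e.
- by move=> _ _ [e]; have := nT z; rewrite e.
move=> _ _ [e1 -> e2]; rewrite (IH w) //.
by rewrite [LHS]surjective_pairing e1 e2 -surjective_pairing.
Qed.

(** * The two classes of avoiders *)

Lemma order_isomorphic3 (a b c x y z : nat) :
  order_isomorphic [:: a; b; c] [:: x; y; z] =
  [&& (a < b) == (x < y), (a < c) == (x < z), (b < a) == (y < x),
      (b < c) == (y < z), (c < a) == (z < x) & (c < b) == (z < y)].
Proof.
apply/andP/andP => [[_ /forallP iso]|[h1 /and5P[h2 h3 h4 h5 h6]]].
  have {}iso i j (hi : i < 3) (hj : j < 3) :
      (nth 0 [:: a; b; c] i < nth 0 [:: a; b; c] j) ==
      (nth 0 [:: x; y; z] i < nth 0 [:: x; y; z] j).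
    by have /forallP/(_ (Ordinal hj)) := iso (Ordinal hi).
  split; first exact: (iso 0 1 isT isT).
  apply/and5P; split; [exact: (iso 0 2 isT isT) | exact: (iso 1 0 isT isT)
    | exact: (iso 1 2 isT isT) | exact: (iso 2 0 isT isT)
    | exact: (iso 2 1 isT isT)].
split=> //; apply/forallP => -[[|[|[|i]]] hi] //; apply/forallP;
  by case=> [[|[|[|j]]] hj] //=; rewrite ?ltnn.
Qed.

Lemma order_isomorphic132 (a b c : nat) :
  order_isomorphic [:: a; b; c] [:: 1; 3; 2] = (a < c < b).
Proof. by rewrite order_isomorphic3 /=; lia. Qed.

Lemma order_isomorphic231 (a b c : nat) :
  order_isomorphic [:: a; b; c] [:: 2; 3; 1] = (c < a < b).
Proof. by rewrite order_isomorphic3 /=; lia. Qed.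

Lemma order_isomorphic312 (a b c : nat) :
  order_isomorphic [:: a; b; c] [:: 3; 1; 2] = (b < c < a).
Proof. by rewrite order_isomorphic3 /=; lia. Qed.

Lemma order_isomorphic321 (a b c : nat) :
  order_isomorphic [:: a; b; c] [:: 3; 2; 1] = (c < b < a).
Proof. by rewrite order_isomorphic3 /=; lia. Qed.

Lemma avoids3P (w : word) (x y z : nat) :
  reflect (forall a b c, subseq [:: a; b; c] w ->
             ~~ order_isomorphic [:: a; b; c] [:: x; y; z])
          (avoids w [:: x; y; z]).
Proof.
apply: (iffP idP) => [/containsP h a b c s_w|h].
  by apply/negP => iso; apply: h; exists [:: a; b; c].
apply/containsP => -[u u_w]; case: u u_w => [|a [|b [|c [|]]]] //= u_w;
  try by case/andP.
exact/negP/h.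
Qed.

Lemma subseq2_pairwise (T : eqType) (r : rel T) (s : seq T) :
  (forall b c, subseq [:: b; c] s -> r b c) <-> pairwise r s.
Proof.
split=> [|pw b c /subseq_pairwise /(_ pw) /=]; last by rewrite !andbT.
elim: s => //= x s IH h; apply/andP; split.
  apply/allP => c s_c; apply: h; rewrite eqxx sub1seq //.
apply: IH => b c bc; apply: h; case: eqP => // _.
by apply: subseq_trans bc; apply: subseq_cons.
Qed.

Lemma perm_map_iota (f : nat -> nat) n : injective f ->
  (forall i, i < n -> 0 < f i <= n) -> perm_eq (map f (iota 0 n)) (iota 1 n).
Proof.
move=> f_inj f_n; have u : uniq (map f (iota 0 n)).
  by rewrite map_inj_uniq ?iota_uniq.
have sub : {subset map f (iota 0 n) <= iota 1 n}.
  by move=> _ /mapP[i + ->]; rewrite !mem_iota => /f_n.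
have [|_ eqi] := uniq_min_size u sub; first by rewrite size_map !size_iota.
exact: uniq_perm u (iota_uniq _ _) eqi.
Qed.

Lemma lead_word_inj k : injective (lead_word k).
Proof.
by move=> i j; rewrite /lead_word; case: eqP; case: eqP;
   case: (leqP i k); case: (leqP j k); lia.
Qed.

Lemma dip_word_inj k : injective (dip_word k).
Proof.
by move=> i j; rewrite /dip_word; case: (ltngtP i k); case: (ltngtP j k); lia.
Qed.

Lemma perm_lead_word k n : k < n ->
  perm_eq (map (lead_word k) (iota 0 n)) (iota 1 n).
Proof.
move=> kn; apply: perm_map_iota (@lead_word_inj k) _ => i.
by rewrite /lead_word; case: eqP; case: (leqP i k); lia.
Qed.

Lemma perm_dip_word k n : k < n ->
  perm_eq (map (dip_word k) (iota 0 n)) (iota 1 n).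
Proof.
move=> kn; apply: perm_map_iota (@dip_word_inj k) _ => i.
by rewrite /dip_word; case: (ltngtP i k); lia.
Qed.

Lemma map_lead_word k n : 0 < n ->
  map (lead_word k) (iota 0 n) = k.+1 :: map (lead_word k) (iota 1 n.-1).
Proof. by case: n. Qed.

Lemma pairwise_lead_word k m n : 0 < m ->
  pairwise ltn (map (lead_word k) (iota m n)).
Proof.
move=> m0; rewrite pairwise_map.
apply: (sub_in_pairwise (P := fun i => 0 < i) (r := ltn)).
- by move=> i j i0 _ /=; apply: lead_word_mono.
- by apply/allP => i; rewrite mem_iota; lia.
- by rewrite -sorted_pairwise ?iota_ltn_sorted //; apply: ltn_trans.
Qed.

Lemma pairwise_dip_word k n :
  pairwise ltn [seq x <- map (dip_word k) (iota 0 n) | x != 1].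
Proof.
rewrite filter_map pairwise_map.
apply: (sub_in_pairwise (P := fun i => i != k) (r := ltn)).
- by move=> i j _ jk /= ij; apply: dip_word_mono.
- apply/allP => i; rewrite mem_filter /= => /andP[+ _].
  by apply: contraNneq => ->; rewrite dip_word_eq.
- apply: subseq_pairwise (filter_subseq _ _) _.
  by rewrite -sorted_pairwise ?iota_ltn_sorted //; apply: ltn_trans.
Qed.

Lemma pairwise_ltn_eq (s t : seq nat) :
  pairwise ltn s -> pairwise ltn t -> perm_eq s t -> s = t.
Proof.
move=> s_lt t_lt /perm_mem st.
apply: (@irr_sorted_eq _ ltn) st; [exact: ltn_trans | exact: ltnn | |];
  exact: pairwise_sorted.
Qed.

Lemma mem_Av n (ts : seq word) (w : word) :
  (w \in Av n ts) = perm_eq w (iota 1 n) && all (avoids w) ts.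
Proof. by rewrite -mem_Sn !inE. Qed.

(** A descending pair after the first letter forms with it 132, 231 or 321, according to the rank of
    that letter. So all letters after the first increase; conversely each pattern ends in a
    descending pair. *)
Lemma Av_lead_word n (w : word) : 0 < n ->
  (w \in Av n [:: [:: 1; 3; 2]; [:: 2; 3; 1]; [:: 3; 2; 1]]) <->
  exists2 k, k < n & w = map (lead_word k) (iota 0 n).
Proof.
move=> n0; rewrite mem_Av /= andbT; split.
  case/and4P=> w_perm /avoids3P av132 /avoids3P av231 /avoids3P av321.
  case: w w_perm av132 av231 av321 => [|x s].
    by move/perm_size; rewrite size_iota /=; lia.
  move=> w_perm av132 av231 av321.
  have /= : uniq (x :: s) by rewrite (perm_uniq w_perm) iota_uniq.
  move=> /andP[xs us].
  have s_lt : pairwise ltn s.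
    apply/subseq2_pairwise => b c bc.
    have sub : subseq [:: x; b; c] (x :: s) by rewrite /= eqxx.
    move: {av132 av231 av321}
      (av132 _ _ _ sub) (av231 _ _ _ sub) (av321 _ _ _ sub).
    rewrite order_isomorphic132 order_isomorphic231 order_isomorphic321.
    have : uniq [:: x; b; c] by apply: (subseq_uniq sub); rewrite /= xs us.
    by rewrite /= !inE; clear; lia.
  have := perm_mem w_perm x; rewrite mem_head mem_iota => /esym hx.
  exists x.-1; first lia.
  have := @perm_lead_word x.-1 n; rewrite map_lead_word // prednK; last by lia.
  have xn : x <= n by lia.
  move=> /(_ xn); rewrite -(permPr w_perm) perm_sym perm_cons => perm_s.
  congr (_ :: _); apply: pairwise_ltn_eq => //.
  exact: pairwise_lead_word.
case=> k kn ->; rewrite perm_lead_word //= map_lead_word //.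
have lt a b c : subseq [:: a; b; c] (k.+1 :: map (lead_word k) (iota 1 n.-1)) ->
    b < c.
  move=> sub; have: pairwise ltn (map (lead_word k) (iota 1 n.-1)).
    exact: pairwise_lead_word.
  move/subseq2_pairwise; apply; move: sub; rewrite /=.
  by case: eqP => // _; apply: cons_subseq.
apply/and3P; split; apply/avoids3P => a b c /lt.
- by rewrite order_isomorphic132; lia.
- by rewrite order_isomorphic231; lia.
- by rewrite order_isomorphic321; lia.
Qed.

(** A descending pair of letters other than 1 forms with 1 the pattern 132, 312 or 321, according to
    whether 1 comes before, between or after. So the word increases once 1 is deleted; conversely
    each pattern has a descending pair above its least letter. *)
Lemma Av_dip_word n (w : word) : 0 < n ->
  (w \in Av n [:: [:: 1; 3; 2]; [:: 3; 1; 2]; [:: 3; 2; 1]]) <->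
  exists2 k, k < n & w = map (dip_word k) (iota 0 n).
Proof.
move=> n0; rewrite mem_Av /= andbT; split.
  case/and4P=> w_perm /avoids3P av132 /avoids3P av312 /avoids3P av321.
  have uw : uniq w by rewrite (perm_uniq w_perm) iota_uniq.
  have w1 : 1 \in w by rewrite (perm_mem w_perm) mem_iota; lia.
  have w_gt0 x : x \in w -> 0 < x by rewrite (perm_mem w_perm) mem_iota; lia.
  case/splitPr: w1 w_perm uw w_gt0 av132 av312 av321 => u v.
  move=> w_perm uw w_gt0 av132 av312 av321.
  move: (uw); rewrite cat_uniq /= negb_or => /and4P[uu /andP[u1 uv] v1 vv].
  have w_gt1 x : x \in u ++ v -> 1 < x.
    rewrite mem_cat => x_uv; have : 0 < x.
      by apply: w_gt0; rewrite mem_cat inE; case/orP: x_uv => ->; rewrite ?orbT.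
    rewrite leq_eqVlt => /orP[/eqP x1|//].
    by move: x_uv; rewrite -x1 (negPf u1) (negPf v1).
  have w_lt b c : subseq [:: b; c] (u ++ v) -> b <= c -> b < c.
    move=> bc; rewrite leq_eqVlt => /orP[/eqP e|//].
    have : uniq (u ++ v) by rewrite cat_uniq uu uv vv.
    by move/(subseq_uniq bc); rewrite e /= inE eqxx.
  have uv_sub b c : b \in u -> c \in v -> subseq [:: b; c] (u ++ v).
    by move=> ub vc; apply: (@cat_subseq _ [:: b] [:: c]); rewrite sub1seq.
  have uv_lt : pairwise ltn (u ++ v).
    rewrite pairwise_cat; apply/and3P; split.
    - apply/allrelP => b c ub vc; apply: (w_lt _ _ (uv_sub _ _ ub vc)).
      have c1 : 1 < c by apply: w_gt1; rewrite mem_cat vc orbT.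
      rewrite leqNgt.
      have := av312 b 1 c; rewrite order_isomorphic312 c1; apply.
      apply: (@cat_subseq _ [:: b] [:: 1; c]); rewrite ?sub1seq //.
      by rewrite /= sub1seq.
    - apply/subseq2_pairwise => b c bc.
      have bc' : subseq [:: b; c] (u ++ v).
        exact: subseq_trans bc (prefix_subseq _ _).
      have c1 : 1 < c by apply/w_gt1/(mem_subseq bc'); rewrite !inE eqxx orbT.
      apply: (w_lt _ _ bc'); rewrite leqNgt.
      have := av321 b c 1; rewrite order_isomorphic321 c1; apply.
      by apply: (@cat_subseq _ [:: b; c] [:: 1]); rewrite ?sub1seq ?mem_head.
    - apply/subseq2_pairwise => b c bc.
      have bc' : subseq [:: b; c] (u ++ v).
        exact: subseq_trans bc (suffix_subseq _ _).
      have c1 : 1 < c by apply/w_gt1/(mem_subseq bc'); rewrite !inE eqxx orbT.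
      apply: (w_lt _ _ bc'); rewrite leqNgt.
      have := av132 1 b c; rewrite order_isomorphic132 c1; apply.
      by apply: (@cat_subseq _ [::] [:: 1; b; c]); rewrite ?sub0seq.
  have kn : size u < n.
    by have := perm_size w_perm; rewrite size_iota size_cat /=; lia.
  exists (size u) => //.
  have d_perm := perm_dip_word kn; set d := map _ _ in d_perm *.
  have nth_d : nth 0 d (size u) = 1.
    by rewrite (nth_map 0) ?size_iota // nth_iota // dip_word_eq.
  have ud : uniq d by rewrite (perm_uniq d_perm) iota_uniq.
  have sd : size d = n by rewrite size_map size_iota.
  (* Without the letter 1 both words are increasing on the same letters, hence equal; the position
     of 1 is also the same. *)
  have rem_d : rem 1 d = u ++ v.
    apply: pairwise_ltn_eq => //.
      by rewrite rem_filter //; apply: pairwise_dip_word.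
    have d1 : 1 \in d by rewrite -nth_d mem_nth // sd.
    rewrite -(perm_cons 1) -(permPl (perm_to_rem d1)).
    rewrite perm_sym -[1 :: _]/([:: 1] ++ u ++ v) perm_catCA /=.
    by rewrite (permPl w_perm) perm_sym.
  have id : index 1 d = size u by rewrite -nth_d index_uniq // sd.
  rewrite -[d](cat_take_drop (size u)) (drop_nth 0) ?sd // nth_d.
  move/eqP: rem_d; rewrite remE id eqseq_cat; last first.
    by rewrite size_take_min sd; apply/minn_idPl/ltnW.
  by case/andP=> /eqP-> /eqP->.
case=> k kn ->; rewrite perm_dip_word //=.
have lt b c : subseq [:: b; c] (map (dip_word k) (iota 0 n)) ->
    b != 1 -> c != 1 -> b < c.
  move=> sub b1 c1; have := @pairwise_dip_word k n.
  by move/subseq2_pairwise; apply; rewrite subseq_filter /= b1 c1 sub.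
have gt0 a b c : subseq [:: a; b; c] (map (dip_word k) (iota 0 n)) ->
    [/\ 0 < a, 0 < b & 0 < c].
  move/mem_subseq => h.
  have : all (ltn 0) [:: a; b; c].
    by apply/allP => _ /h/mapP[i _ ->]; apply: dip_word_gt0.
  by rewrite /= andbT => /and3P.
have sub2 a b c : subseq [:: a; b; c] (map (dip_word k) (iota 0 n)) ->
    [/\ subseq [:: a; b] (map (dip_word k) (iota 0 n)),
        subseq [:: a; c] (map (dip_word k) (iota 0 n))
      & subseq [:: b; c] (map (dip_word k) (iota 0 n))].
  have sub_abc m : subseq (mask m [:: a; b; c]) [:: a; b; c].
    exact: mask_subseq.
  move=> abc; split; apply: subseq_trans abc.
  - exact: (sub_abc [:: true; true; false]).
  - exact: (sub_abc [:: true; false; true]).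
  - exact: (sub_abc [:: false; true; true]).
apply/and3P; split; apply/avoids3P => a b c abc;
  have [a0 b0 c0] := gt0 a b c abc; have [ab ac bc] := sub2 a b c abc.
- rewrite order_isomorphic132; have := lt _ _ bc; clear -a0 b0 c0; lia.
- rewrite order_isomorphic312; have := lt _ _ ac; clear -a0 b0 c0; lia.
- rewrite order_isomorphic321; have := lt _ _ ab; clear -a0 b0 c0; lia.
Qed.

(** * Counting balanced codes *)

Fixpoint codes (N : nat) : seq code :=
  if N is N'.+1 then
    [seq a :: c | a <- [:: (false, false); (false, true);
                           (true, false); (true, true)], c <- codes N']
  else [:: [::]].

Lemma mem_codes N c : (c \in codes N) = (size c == N).
Proof.
elim: N c => [|N IH] c; first by rewrite inE size_eq0.
apply/allpairsP/eqP => [[[a d] /= [_ + ->]]|].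
  by rewrite IH => /eqP <-.
case: c => // a c [sc]; exists (a, c); split=> //=; last by rewrite IH sc.
by case: a => [[] []].
Qed.

Lemma codes_uniq N : uniq (codes N).
Proof.
by elim: N => // N IH; apply: allpairs_uniq => // -[a c] [b d] _ _ [-> ->].
Qed.

Lemma count_codesS (P : pred code) N : count P (codes N.+1) =
  count (fun c => P ((false, false) :: c)) (codes N) +
  count (fun c => P ((false, true) :: c)) (codes N) +
  count (fun c => P ((true, false) :: c)) (codes N) +
  count (fun c => P ((true, true) :: c)) (codes N).
Proof. by rewrite /= !count_cat !count_map !addnA addn0. Qed.

(** Used to split off a first letter that contributes [i] and [j] to the two statistics. The guard
    is there because subtraction truncates. *)
Lemma count_shift (u v : code -> nat) (g : nat -> nat -> nat) (s : seq code)
    (i j : bool) p q :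
  (forall p q, count (fun c => (u c == p) && (v c == q)) s = g p q) ->
  count (fun c => (i + u c == p) && (j + v c == q)) s =
    if (i <= p) && (j <= q) then g (p - i) (q - j) else 0.
Proof.
move=> <-; have [/andP[ip jq]|out] := boolP (_ && _).
  by apply: eq_count => c; rewrite -{1}(subnKC ip) -{1}(subnKC jq) !eqn_add2l.
rewrite -(count_pred0 s); apply: eq_count => c /=; apply: contraNF out.
by case/andP=> /eqP<- /eqP<-; rewrite !leq_addr.
Qed.

Definition nleftless (c : code) : nat := count (fun a => ~~ a.1) c.

(** Adding the letters 01 to both sides turns the equality of leaves and forks into one between a
    statistic of the second bits and one of the first bits, which vary independently. *)
Lemma balancedE c : balanced c = (nright c == nleftless c).
Proof.
rewrite /balanced eq_sym.
suff : nfork c + nleftless c = nleaf c + nright c by lia.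
rewrite /nfork /nleftless /nleaf /nright; elim: c => //= a c.
case: a => [[] []] /=; move: (count _ c) (count _ c) (count _ c) (count _ c).
all: by lia.
Qed.

Lemma count_nright_nleftless N p q :
  count (fun c => (nright c == p) && (nleftless c == q)) (codes N) =
    'C(N, p) * 'C(N, q).
Proof.
elim: N p q => [|N IH] p q; first by case: p q => [|p] [|q].
have sh i j := @count_shift nright nleftless _ _ i j p q IH.
rewrite count_codesS (sh false true) (sh true true) (sh false false).
rewrite (sh true false) {sh IH}.
by case: p q => [|p] [|q]; rewrite /= ?bin0 ?binS ?subn0 ?subn1 /=; ring.
Qed.

Lemma count_balanced_nright N m :
  count (fun c => balanced c && (nright c == m)) (codes N) = 'C(N, m) ^ 2.
Proof.
rewrite expnS expn1 -count_nright_nleftless; apply: eq_count => c.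
rewrite balancedE; case: (eqVneq (nright c) m) => [->|].
  by rewrite andbT eq_sym.
by rewrite andbF.
Qed.

(** Summing over the value of [nright] gives a sum of squared binomial coefficients, evaluated by
    Vandermonde's identity. *)
Lemma count_balanced N : count balanced (codes N) = 'C(2 * N, N).
Proof.
rewrite mul2n -addnn -Vandermonde.
transitivity (\sum_(m < N.+1)
    count (fun c => balanced c && (nright c == m)) (codes N)); last first.
  apply: eq_bigr => m _; rewrite count_balanced_nright bin_sub ?mulnn //.
  by rewrite -ltnS ltn_ord.
rewrite -sum1_count.
transitivity (\sum_(m < N.+1)
    \sum_(c <- codes N | balanced c && (nright c == m)) 1); last first.
  by apply: eq_bigr => m _; rewrite sum1_count.
rewrite (exchange_big_dep balanced) /=; last by move=> m c _ /andP[].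
rewrite big_seq_cond [RHS]big_seq_cond; apply: eq_bigr => c /andP[].
rewrite mem_codes => /eqP sc bc.
have lt_c : nright c < N.+1 by rewrite ltnS -sc; apply: count_size.
rewrite (big_pred1 (Ordinal lt_c)) // => m.
by rewrite bc /= -val_eqE eq_sym.
Qed.

(** Choose the places of forks and leaves together, then those of the forks among them; every other
    letter is 01 or 10. *)
Lemma count_nfork_nleaf N p q :
  count (fun c => (nfork c == p) && (nleaf c == q)) (codes N) =
    2 ^ (N - (p + q)) * 'C(N, p + q) * 'C(p + q, p).
Proof.
elim: N p q => [|N IH] p q; first by case: p q => [|p] [|q].
have sh i j := @count_shift nfork nleaf _ _ i j p q IH.
rewrite count_codesS (sh false true) (sh true false) !(sh false false) {sh IH}.
(* For [k] at least [N] the exponents truncate to 0, and the identity holds because the binomial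
   coefficient vanishes. *)
have pow k : 2 ^ (N - k.+1) * 'C(N, k.+1) * 2 = 2 ^ (N - k) * 'C(N, k.+1).
  have [lt_k|le_k] := ltnP k N; last by rewrite bin_small ?muln0.
  by rewrite -(subnSK lt_k) expnS; ring.
case: p q => [|p] [|q]; rewrite /= ?subn0 ?subn1 /= ?addn0 ?add0n ?bin0 ?bin1.
- by rewrite expnS; ring.
- rewrite subSS binS mulnDr -pow; ring.
- rewrite subSS !binn binS mulnDr -pow; ring.
rewrite !(addSn, addnS) subSS (binS N) mulnDr -pow (binS (p + q).+1).
ring.
Qed.

Lemma count_balanced_nfork N m :
  count (fun c => balanced c && (nfork c == m)) (codes N) =
    2 ^ (N - 2 * m) * 'C(N, 2 * m) * 'C(2 * m, m).
Proof.
rewrite mul2n -addnn -count_nfork_nleaf; apply: eq_count => c.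
by rewrite /balanced andbC; case: eqVneq => // ->.
Qed.

(** * From contexts to preimages under the stack-sorting map *)

Local Open Scope fset_scope.

Lemma exists_contexts (s : seq code) : all balanced s ->
  exists zs, map context_code zs = s.
Proof.
elim: s => [|c s IH] /=; first by exists [::].
by move=> /andP[/context_code_surj[z <-] /IH[zs <-]]; exists (z :: zs).
Qed.

(** Contexts are the middle term of a bijection between [X] and balanced words; [P] and [Q] are one
    statistic seen on the two sides. *)
Lemma card_contexts (F : context -> word) (X : {fset word}) N :
  (forall w, w \in X <-> exists2 z, csize z = N & w = F z) ->
  {in [pred z | csize z == N] &, injective F} ->
  forall (P : pred word) (Q : pred code),
  (forall z, csize z = N -> P (F z) = Q (context_code z)) ->
  #|` [fset w in X | P w]| = count (fun c => balanced c && Q c) (codes N).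
Proof.
move=> XF F_inj P Q PQ.
pose s := [seq c <- codes N | balanced c && Q c].
have [zs ezs] : exists zs, map context_code zs = s.
  apply: exists_contexts; apply/allP => c.
  by rewrite mem_filter => /andP[/andP[]].
have zs_size z : z \in zs -> csize z = N.
  move=> /(map_f context_code); rewrite ezs mem_filter mem_codes.
  by rewrite size_context_code => /andP[_ /eqP].
rewrite -size_filter -/s -ezs size_map -(size_map F).
apply: perm_size; apply: uniq_perm; first exact: fset_uniq.
  rewrite map_inj_in_uniq => [|z1 z2 /zs_size h1 /zs_size h2].
    by apply: (@map_uniq _ _ context_code); rewrite ezs filter_uniq ?codes_uniq.
  by apply: F_inj; rewrite inE ?h1 ?h2.
move=> w; apply/idP/mapP.
  rewrite !inE => /andP[/XF[z zN ->]]; rewrite PQ // => Qz.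
  exists z => //; rewrite -(mem_map context_code_inj) ezs mem_filter Qz andbT.
  by rewrite context_code_balanced mem_codes size_context_code zN /=.
case=> z z_zs ->; rewrite !inE PQ ?zs_size //; apply/andP; split.
  by apply/XF; exists z; rewrite ?zs_size.
have := map_f context_code z_zs; rewrite ezs mem_filter.
by case/andP=> /andP[].
Qed.

Lemma preim_inorder (f : nat -> nat -> nat) n ts :
  (forall w, w \in Av n ts <-> exists2 k, k < n & w = map (f k) (iota 0 n)) ->
  forall w, w \in stack_sort_preim n (Av n ts) <-> exists k t,
    [/\ k < n, nodes t = n, decreasing (f k) 0 t & w = inorder (f k) 0 t].
Proof.
move=> Avf w; have -> : (w \in stack_sort_preim n (Av n ts)) =
    (w \in Sn n) && (stack_sort w \in Av n ts) by rewrite !inE.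
rewrite mem_Sn; split.
  case/andP=> w_perm /Avf[k kn sw].
  have sz : size w = n by rewrite (perm_size w_perm) size_iota.
  have uw : uniq w by rewrite (perm_uniq w_perm) iota_uniq.
  rewrite -[in iota 0 n]sz in sw.
  have [t dt def_w] := inorder_surj uw sw.
  by exists k, t; split; rewrite // -sz def_w size_inorder.
case=> k [t [kn tn dt ->]].
have st : stack_sort (inorder (f k) 0 t) \in Av n ts.
  by apply/Avf; exists k; rewrite // stack_sort_inorder // tn.
rewrite st andbT -(permPl (perm_stack_sort _)).
by move: st; rewrite mem_Av => /andP[].
Qed.

Definition dip_perm (z : context) : word :=
  inorder (dip_word (left_size z)) 0 (plug leaf z).

Definition lead_perm (z : context) : word :=
  inorder (lead_word (lead_tree z).2) 0 (lead_tree z).1.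

Lemma mem_preim_dip n w : 0 < n ->
  w \in stack_sort_preim n (Av n [:: [:: 1; 3; 2]; [:: 3; 1; 2]; [:: 3; 2; 1]])
  <-> exists2 z, csize z = n - 1 & w = dip_perm z.
Proof.
move=> n0; rewrite (preim_inorder (fun w => Av_dip_word w n0)); split.
  case=> k [t [kn tn dt ->]]; have [|z et ek] := decreasing_dip_inv dt.
    by rewrite tn.
  exists z; last by rewrite et ek.
  by rewrite -tn et nodes_plug /= add1n subn1.
case=> z zn ->; exists (left_size z), (plug leaf z); split=> //.
- by have := left_size_le z; lia.
- by rewrite nodes_plug /=; lia.
- exact: (decreasing_dip_plug 0 z).
Qed.

Lemma mem_preim_lead n w : 0 < n ->
  w \in stack_sort_preim n (Av n [:: [:: 1; 3; 2]; [:: 2; 3; 1]; [:: 3; 2; 1]])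
  <-> exists2 z, csize z = n - 1 & w = lead_perm z.
Proof.
move=> n0; rewrite (preim_inorder (fun w => Av_lead_word w n0)); split.
  case=> k [t [kn tn dt ->]]; have [|z ez] := decreasing_lead_inv dt.
    by rewrite tn.
  exists z; last by rewrite /lead_perm ez.
  by have := nodes_lead_tree z; rewrite ez /= tn => ->; rewrite subn1.
case=> z zn ->; exists (lead_tree z).2, (lead_tree z).1.
have := lead_tree_lt z; have := nodes_lead_tree z => nT; split=> //; try lia.
exact: decreasing_lead_tree.
Qed.

(** Sorting recovers the word of labels, where the position of 1 is the index of the marked leaf.
    With the labels known, the word determines the tree. *)
Lemma dip_perm_inj z1 z2 :
  csize z1 = csize z2 -> dip_perm z1 = dip_perm z2 -> z1 = z2.
Proof.
move=> ez e; have d1 := decreasing_dip_plug 0 z1.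
have d2 := decreasing_dip_plug 0 z2.
have := congr1 stack_sort e; rewrite !stack_sort_inorder //.
rewrite !nodes_plug ez => /eq_in_map /(_ (left_size z1)).
have lt_k : left_size z1 < 1 + csize z2.
  by rewrite -ez add1n ltnS left_size_le.
rewrite mem_iota /= lt_k dip_word_eq /dip_word => /(_ isT).
case: (ltngtP (left_size z1)) => // [lt|ek _]; first by case; lia.
apply: (plug_inj (x := leaf) (y := leaf) isT isT _ _).2; first by rewrite ek.
move: d1 d2 e; rewrite /dip_perm ek; exact: inorder_inj.
Qed.

(** Here the index is read off the first letter of the sorted word. *)
Lemma lead_perm_inj z1 z2 :
  csize z1 = csize z2 -> lead_perm z1 = lead_perm z2 -> z1 = z2.
Proof.
move=> ez e; have d1 := decreasing_lead_tree z1.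
have d2 := decreasing_lead_tree z2.
have := congr1 stack_sort e; rewrite !stack_sort_inorder //.
rewrite !nodes_lead_tree ez /= => -[ek _]; apply: lead_tree_inj.
rewrite [LHS]surjective_pairing [RHS]surjective_pairing ek; congr (_, _).
by move: d1 d2 e; rewrite /lead_perm ek; apply: inorder_inj.
Qed.

Lemma perm_code_context z :
  perm_eq (tree_code (plug leaf z)) ((false, false) :: path_code z).
Proof. exact: (@perm_plug_code leaf z isT). Qed.

Lemma descents_dip_perm z :
  size (descents (dip_perm z)) = nright (context_code z).
Proof.
rewrite descents_inorder; last exact: (decreasing_dip_plug 0 z).
by rewrite nright_context; exact: (permP (perm_code_context z) snd).
Qed.

Lemma peaks_dip_perm z : size (peaks (dip_perm z)) = nfork (context_code z).
Proof.
rewrite peaks_inorder; last exact: (decreasing_dip_plug 0 z).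
by rewrite nfork_context; exact: (permP (perm_code_context z) _).
Qed.

Lemma descents_lead_perm z :
  size (descents (lead_perm z)) = nright (context_code z).
Proof.
rewrite descents_inorder; last exact: decreasing_lead_tree.
rewrite nright_context.
exact: etrans (permP (perm_lead_tree z) snd) (permP (perm_code_context z) snd).
Qed.

Lemma peaks_lead_perm z : size (peaks (lead_perm z)) = nfork (context_code z).
Proof.
rewrite peaks_inorder; last exact: decreasing_lead_tree.
rewrite nfork_context.
exact: etrans (permP (perm_lead_tree z) _) (permP (perm_code_context z) _).
Qed.

Lemma card_statistics (F : context -> word) (X : {fset word}) N :
  (forall w, w \in X <-> exists2 z, csize z = N & w = F z) ->
  (forall z1 z2, csize z1 = csize z2 -> F z1 = F z2 -> z1 = z2) ->
  (forall z, size (descents (F z)) = nright (context_code z)) ->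
  (forall z, size (peaks (F z)) = nfork (context_code z)) ->
  [/\ #|` X| = 'C(2 * N, N),
      forall m, #|` with_descents X m| = 'C(N, m) ^ 2
    & forall m, #|` with_peaks X m| =
        2 ^ (N - 2 * m) * 'C(N, 2 * m) * 'C(2 * m, m)].
Proof.
move=> XF F_inj Fdes Fpk.
have inj : {in [pred z | csize z == N] &, injective F}.
  by move=> z1 z2; rewrite !inE => /eqP h1 /eqP h2; apply: F_inj; rewrite h1.
have card := card_contexts XF inj; split=> [|m|m].
- have -> : X = [fset w in X | predT w] by apply/fsetP => w; rewrite !inE andbT.
  rewrite (card predT predT) // -count_balanced.
  by apply: eq_count => c; rewrite andbT.
- rewrite -count_balanced_nright.
  by apply: (card (fun w => size (descents w) == m)) => z _; rewrite Fdes.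
- rewrite -count_balanced_nfork.
  by apply: (card (fun w => size (peaks w) == m)) => z _; rewrite Fpk.
Qed.

Theorem theorem5p2 (n : nat) (hn : 1 <= n) :
  let A := stack_sort_preim n (Av n [:: [:: 1; 3; 2]; [:: 2; 3; 1]; [:: 3; 2; 1]]) in
  let B := stack_sort_preim n (Av n [:: [:: 1; 3; 2]; [:: 3; 1; 2]; [:: 3; 2; 1]]) in
  [/\ #|` A| = 'C(2 * n - 2, n - 1) /\ #|` B| = 'C(2 * n - 2, n - 1),
      forall m : nat,
        #|` with_descents A m| = 'C(n - 1, m) ^ 2 /\
        #|` with_descents B m| = 'C(n - 1, m) ^ 2
    & forall m : nat,
        #|` with_peaks A m| = 2 ^ (n - 2 * m - 1) * 'C(n - 1, 2 * m) * 'C(2 * m, m) /\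
        #|` with_peaks B m| = 2 ^ (n - 2 * m - 1) * 'C(n - 1, 2 * m) * 'C(2 * m, m)].
Proof.
move=> A B.
have [A1 A2 A3] := card_statistics (fun w => mem_preim_lead w hn)
  lead_perm_inj descents_lead_perm peaks_lead_perm.
have [B1 B2 B3] := card_statistics (fun w => mem_preim_dip w hn)
  dip_perm_inj descents_dip_perm peaks_dip_perm.
have -> : 2 * n - 2 = 2 * (n - 1) by rewrite mulnBr muln1.
by split=> // m; rewrite subnAC.
Qed.
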